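(* Let $F$ be a field and let $V$ be the three-dimensional $F$-vector space with basis $a_1,a_2,a_3$, equipped with the double bracket $$\{\!\{a_1,a_2\}\!\}=-a_1\otimes a_2,\quad \{\!\{a_2,a_1\}\!\}=a_1\otimes a_2,\quad \{\!\{a_2,a_3\}\!\}=a_3\otimes a_2,$$ $$\{\!\{a_3,a_1\}\!\}=a_1\otimes a_3-a_3\otimes a_1,\quad \{\!\{a_3,a_2\}\!\}=-a_3\otimes a_2,$$ all other brackets of basis elements being zero. Then this double bracket defines a modified double Poisson structure on the free associative algebra $A=\mathrm{As}\langle a_1,a_2,a_3\rangle$; that is, its unique extension to a double bracket on $A$ satisfying $$\{\!\{a,bc\}\!\}=(b\otimes 1)\{\!\{a,c\}\!\}+\{\!\{a,b\}\!\}(1\otimes c),\qquad \{\!\{ab,c\}\!\}=(1\otimes a)\{\!\{b,c\}\!\}+\{\!\{a,c\}\!\}(b\otimes 1)$$ for all $a,b,c\in A$ is a modified double Poisson bracket on $A$.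
   Context: A double bracket on a vector space $V$ is a linear map $V\otimes V\to V\otimes V$, $a\otimes b\mapsto\{\!\{a,b\}\!\}$. Let $A$ be an associative algebra with product $\mu(a\otimes b)=ab$. A modified double Poisson bracket on $A$ is a double bracket $\{\!\{\cdot,\cdot\}\!\}$ on $A$ such that, with $\{a,b\}:=\mu(\{\!\{a,b\}\!\})$, for all $a,b,c\in A$: (1) $\{\!\{a,bc\}\!\}=(b\otimes 1)\{\!\{a,c\}\!\}+\{\!\{a,b\}\!\}(1\otimes c)$; (2) $\{\!\{ab,c\}\!\}=(1\otimes a)\{\!\{b,c\}\!\}+\{\!\{a,c\}\!\}(b\otimes 1)$; (3) $\{a,\{b,c\}\}-\{b,\{a,c\}\}=\{\{a,b\},c\}$; (4) $\{a,b\}+\{b,a\}\in[A,A]$. Products in $A\otimes A$ are componentwise, and $[A,A]$ is the linear span of all commutators $xy-yx$, $x,y\in A$. *)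

(* Defs.v *)
From HB Require Import structures.
From mathcomp Require Import all_boot all_order all_algebra.
From mathcomp Require Import finmap.
From mathcomp.multinomials Require Import monalg.

Set Implicit Arguments.
Unset Strict Implicit.
Unset Printing Implicit Defensive.

Import GRing.Theory.
Local Open Scope ring_scope.

(* [{malg F[K]}] is the F-vector space with basis K; when K is a monoid it is
   the monoid algebra.  In particular [{malg F[{fmonom I}]}], over the free
   monoid on I, is the free unital associative algebra on I. *)

Section LinearExtension.
Variables (F : fieldType) (K : choiceType) (W : lmodType F) (f : K -> W).

Definition linext (g : {malg F[K]}) : W := \sum_(k <- msupp g) g@_k *: f k.

Lemma linextEw (d : {fset K}) (g : {malg F[K]}) : (msupp g `<=` d)%fset ->
  linext g = \sum_(k <- d) g@_k *: f k.
Proof.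
move=> le; rewrite /linext (big_fset_incl _ le) //= => k _ /mcoeff_outdom ->.
by rewrite scale0r.
Qed.

Lemma linext_is_linear : linear linext.
Proof.
move=> c g h; pose d := (msupp g `|` msupp h)%fset.
have leg : (msupp g `<=` d)%fset by rewrite fsubsetUl.
have leh : (msupp h `<=` d)%fset by rewrite fsubsetUr.
have leZ := fsubset_trans (msuppZ_le c g) leg.
have leD : (msupp (c *: g + h) `<=` d)%fset.
  by apply: fsubset_trans (msuppD_le _ _) _; rewrite fsubUset leZ leh.
rewrite (linextEw leD) (linextEw leg) (linextEw leh) scaler_sumr -big_split /=.
by apply: eq_bigr => k _; rewrite mcoeffD mcoeffZ scalerDl scalerA.
Qed.

HB.instance Definition _ :=
  GRing.isLinear.Build F {malg F[K]} W *:%R linext linext_is_linear.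

Lemma linextU k : linext << k >> = f k.
Proof. by rewrite (linextEw msuppU_le) big_seq_fset1 mcoeffUU scale1r. Qed.

End LinearExtension.

Lemma malgUZ (F : fieldType) (K : choiceType) (c : F) (k : K) :
  << c *g k >> = c *: << k >> :> {malg F[K]}.
Proof. by apply/malgP => l; rewrite mcoeffZ !mcoeffU mulrnAr mulr1. Qed.

Lemma linext_unique (F : fieldType) (K : choiceType) (W : lmodType F)
    (f g : {linear {malg F[K]} -> W}) :
  (forall k, f << k >> = g << k >>) -> f =1 g.
Proof.
move=> eqfg x; rewrite [x]monalgE !linear_sum; apply: eq_bigr => k _.
by rewrite malgUZ !linearZ /= eqfg.
Qed.

(* The tensor product of the spaces with bases K and L is the space with basis
   K * L.  [tens_universal] is its universal property. *)
Section Tensor.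
Variables (F : fieldType) (K L : choiceType).

Definition tens (g : {malg F[K]}) (h : {malg F[L]}) : {malg F[(K * L)%type]} :=
  \sum_(k <- msupp g) \sum_(l <- msupp h) << g@_k * h@_l *g (k, l) >>.

End Tensor.

Notation "g ⊗ h" := (tens g h) (at level 40, left associativity) : ring_scope.

Section TensorTheory.
Variables (F : fieldType) (K L : choiceType).
Implicit Types (g : {malg F[K]}) (h : {malg F[L]}).

Lemma mcoeff_tens g h k l : (g ⊗ h)@_(k, l) = g@_k * h@_l.
Proof.
rewrite /tens raddf_sum /=.
rewrite [g in RHS]monalgE [h in RHS]monalgE !raddf_sum /= mulr_suml.
apply: eq_bigr => k' _; rewrite raddf_sum /= mulr_sumr; apply: eq_bigr => l' _.
rewrite !mcoeffU xpair_eqE.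
by case: (k' == k); case: (l' == l); rewrite ?mulr0n ?mulr1n ?mulr0 ?mul0r.
Qed.

Lemma tensU k l : << k >> ⊗ << l >> = << (k, l) >> :> {malg F[(K * L)%type]}.
Proof.
apply/malgP => -[k' l']; rewrite mcoeff_tens !mcoeffU xpair_eqE.
by case: (k == k'); case: (l == l'); rewrite ?mulr0n ?mulr1n ?mulr0 ?mul0r ?mulr1.
Qed.

Lemma tens_linearl h : linear (fun g => g ⊗ h).
Proof.
move=> c g g'; apply/malgP => -[k l].
by rewrite mcoeffD mcoeffZ !mcoeff_tens mcoeffD mcoeffZ mulrDl mulrA.
Qed.

Lemma tens_linearr g : linear (fun h => g ⊗ h).
Proof.
move=> c h h'; apply/malgP => -[k l].
by rewrite mcoeffD mcoeffZ !mcoeff_tens mcoeffD mcoeffZ mulrDr mulrCA.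
Qed.

Lemma tens_universal (W : lmodType F) (b : {malg F[K]} -> {malg F[L]} -> W) :
    (forall h, linear (fun g => b g h)) -> (forall g, linear (b g)) ->
  exists f : {linear {malg F[(K * L)%type]} -> W},
    (forall g h, f (g ⊗ h) = b g h) /\
    (forall f' : {linear {malg F[(K * L)%type]} -> W},
       (forall g h, f' (g ⊗ h) = b g h) -> f' =1 f).
Proof.
move=> linl linr; pose f := linext (fun p : (K * L)%type => b << p.1 >> << p.2 >>).
exists f; split; last first.
  move=> f' f'b; apply: linext_unique => -[k l].
  by rewrite [RHS]linextU -tensU f'b.
move=> g h.
have Zl h0 c g0 : b (c *: g0) h0 = c *: b g0 h0.
  pose bl : {linear {malg F[K]} -> W} :=
    HB.pack (b^~ h0) (GRing.isLinear.Build _ _ _ _ _ (linl h0)).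
  exact: (linearZ_LR bl).
have Zr g0 c h0 : b g0 (c *: h0) = c *: b g0 h0.
  pose br : {linear {malg F[L]} -> W} :=
    HB.pack (b g0) (GRing.isLinear.Build _ _ _ _ _ (linr g0)).
  exact: (linearZ_LR br).
have sl h0 r (G : K -> {malg F[K]}) :
    b (\sum_(k <- r) G k) h0 = \sum_(k <- r) b (G k) h0.
  pose bl : {linear {malg F[K]} -> W} :=
    HB.pack (b^~ h0) (GRing.isLinear.Build _ _ _ _ _ (linl h0)).
  exact: (linear_sum bl).
have sr g0 r (G : L -> {malg F[L]}) :
    b g0 (\sum_(l <- r) G l) = \sum_(l <- r) b g0 (G l).
  pose br : {linear {malg F[L]} -> W} :=
    HB.pack (b g0) (GRing.isLinear.Build _ _ _ _ _ (linr g0)).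
  exact: (linear_sum br).
rewrite /tens linear_sum [g in RHS]monalgE sl.
apply: eq_bigr => k _; rewrite (malgUZ g@_k) Zl linear_sum /=.
rewrite [h in RHS]monalgE sr scaler_sumr.
apply: eq_bigr => l _; rewrite (malgUZ h@_l) Zr scalerA.
by rewrite (malgUZ (g@_k * h@_l)) linearZ_LR /= /f linextU.
Qed.

End TensorTheory.

(* The monoid structure on pairs makes [{malg F[M * N]}] an algebra; its product
   is the componentwise one, see [tensM]. *)
Section PairMonom.
Variables M N : monomType.
Implicit Types p q : (M * N)%type.

Definition pair_mone : (M * N)%type := (mone, mone).
Definition pair_mmul p q : (M * N)%type := (mmul p.1 q.1, mmul p.2 q.2).

Lemma pair_mmulA : associative pair_mmul.
Proof. by move=> p q r; rewrite /pair_mmul /= !mulmA. Qed.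

Lemma pair_mmul1m : left_id pair_mone pair_mmul.
Proof. by case=> p q; rewrite /pair_mmul /= !mul1m. Qed.

Lemma pair_mmulm1 : right_id pair_mone pair_mmul.
Proof. by case=> p q; rewrite /pair_mmul /= !mulm1. Qed.

Lemma pair_munit p q :
  pair_mmul p q = pair_mone -> p = pair_mone /\ q = pair_mone.
Proof.
by case: p q => [p1 p2] [q1 q2] [/unitm [-> ->] /unitm [-> ->]].
Qed.

HB.instance Definition _ := Choice_isMonomialDef.Build (M * N)%type
  pair_mmulA pair_mmul1m pair_mmulm1 pair_munit.

End PairMonom.

Section TensorAlgebra.
Variables (F : fieldType) (M : monomType).
Local Notation A := {malg F[M]}.
Local Notation AA := {malg F[(M * M)%type]}.

Lemma tensM (a b c d : A) : (a ⊗ b) * (c ⊗ d) = (a * c) ⊗ (b * d).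
Proof.
have tensUU x y k l :
    << x *g k >> ⊗ << y *g l >> = << x * y *g (k, l) >> :> AA.
  apply/malgP => -[k' l']; rewrite mcoeff_tens !mcoeffU xpair_eqE.
  by case: (k == k'); case: (l == l'); rewrite ?mulr0n ?mulr1n ?mulr0 ?mul0r.
have tensDl x y z : (x + y) ⊗ z = x ⊗ z + y ⊗ z :> AA.
  by apply/malgP => -[k l]; rewrite mcoeffD !mcoeff_tens mcoeffD mulrDl.
have tensDr x y z : z ⊗ (x + y) = z ⊗ x + z ⊗ y :> AA.
  by apply/malgP => -[k l]; rewrite mcoeffD !mcoeff_tens mcoeffD mulrDr.
have tens0l z : 0 ⊗ z = 0 :> AA.
  by apply/malgP => -[k l]; rewrite mcoeff_tens !mcoeff0 mul0r.
have tens0r z : z ⊗ 0 = 0 :> AA.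
  by apply/malgP => -[k l]; rewrite mcoeff_tens !mcoeff0 mulr0.
have ind (P : A -> Prop) : P 0 -> (forall x y, P x -> P y -> P (x + y)) ->
    (forall x k, P << x *g k >>) -> forall x, P x.
  by move=> P0 PD PU x; rewrite [x]monalgE; apply: big_ind => // k _.
have UU (N : monomType) x y (k l : N) :
    << x *g k >> * << y *g l >> = << x * y *g mmul k l >> :> {malg F[N]}.
  exact: fgmulUU.
elim/ind: a => [|a a' IH IH'|x k]; first by rewrite !(mul0r, tens0l).
  by rewrite mulrDl !tensDl mulrDl IH IH'.
elim/ind: b => [|b b' IH IH'|y l]; first by rewrite !(mul0r, tens0r).
  by rewrite mulrDl !tensDr mulrDl IH IH'.
elim/ind: c => [|c c' IH IH'|z m]; first by rewrite !(mulr0, tens0l).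
  by rewrite mulrDr !tensDl mulrDr IH IH'.
elim/ind: d => [|d d' IH IH'|t n]; first by rewrite !(mulr0, tens0r).
  by rewrite mulrDr !tensDr mulrDr IH IH'.
by rewrite !(tensUU, UU) mulrACA.
Qed.

Definition mu : {linear AA -> A} :=
  linext (fun p : (M * M)%type => << mmul p.1 p.2 >> : A).

Lemma mu_tens (a b : A) : mu (a ⊗ b) = a * b.
Proof.
rewrite /tens linear_sum malgME /=; apply: eq_bigr => k _.
rewrite linear_sum /=; apply: eq_bigr => l _.
by rewrite malgUZ linearZ_LR /= /mu linextU -malgUZ.
Qed.

End TensorAlgebra.

Section DoubleBracket.
Variables (F : fieldType) (K : choiceType).

Definition double_bracket := {linear {malg F[(K * K)%type]} -> {malg F[(K * K)%type]}}.

Definition dbr (D : double_bracket) (a b : {malg F[K]}) : {malg F[(K * K)%type]} :=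
  D (a ⊗ b).

End DoubleBracket.

Section ModifiedDoublePoisson.
Variables (F : fieldType) (M : monomType).
Local Notation A := {malg F[M]}.
Implicit Types (D : double_bracket F M) (a b c x y : A).

Definition double_leibniz D : Prop :=
  (forall a b c, dbr D a (b * c) = (b ⊗ 1) * dbr D a c + dbr D a b * (1 ⊗ c)) /\
  (forall a b c, dbr D (a * b) c = (1 ⊗ a) * dbr D b c + dbr D a c * (b ⊗ 1)).

Definition sbr D a b : A := mu F M (dbr D a b).

Definition commutator_span x : Prop :=
  exists (n : nat) (c : 'I_n -> F) (y z : 'I_n -> A),
    x = \sum_(i < n) c i *: (y i * z i - z i * y i).

Definition modified_double_poisson D : Prop :=
  [/\ double_leibniz D,
      forall a b c,
        sbr D a (sbr D b c) - sbr D b (sbr D a c) = sbr D (sbr D a b) c &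
      forall a b, commutator_span (sbr D a b + sbr D b a)].

End ModifiedDoublePoisson.

Section FreeAlgebra.
Variables (F : fieldType) (I : choiceType).
Local Notation V := {malg F[I]}.
Local Notation VV := {malg F[(I * I)%type]}.
Local Notation A := {malg F[{fmonom I}]}.
Local Notation AA := {malg F[({fmonom I} * {fmonom I})%type]}.

(* The inclusion of V in the free algebra on a basis of V, and its tensor
   square. *)
Definition incl : {linear V -> A} := linext (fun i => << fmu i >> : A).

Definition incl2 : {linear VV -> AA} :=
  linext (fun p : (I * I)%type => incl << p.1 >> ⊗ incl << p.2 >>).

Definition leibniz_extension (D : double_bracket F I)
    (E : double_bracket F {fmonom I}) : Prop :=
  (forall u v : V, dbr E (incl u) (incl v) = incl2 (dbr D u v)) /\
  double_leibniz E.

End FreeAlgebra.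

Section ThreeDimensional.
Variable F : fieldType.
Local Notation V := {malg F['I_3]}.

Definition a1 : V := << @Ordinal 3 0 isT >>.
Definition a2 : V := << @Ordinal 3 1 isT >>.
Definition a3 : V := << @Ordinal 3 2 isT >>.

(* Indices are shifted: the index of [a_(n+1)] is n. *)
Definition bracket3_basis (p : ('I_3 * 'I_3)%type) : {malg F[('I_3 * 'I_3)%type]} :=
  match val p.1, val p.2 with
  | 0%N, 1%N => - (a1 ⊗ a2)
  | 1%N, 0%N => a1 ⊗ a2
  | 1%N, 2%N => a3 ⊗ a2
  | 2%N, 0%N => a1 ⊗ a3 - a3 ⊗ a1
  | 2%N, 1%N => - (a3 ⊗ a2)
  | _, _ => 0
  end.

Definition bracket3 : double_bracket F 'I_3 := linext bracket3_basis.

Lemma bracket3E :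
  [/\ dbr bracket3 a1 a2 = - (a1 ⊗ a2), dbr bracket3 a2 a1 = a1 ⊗ a2,
      dbr bracket3 a2 a3 = a3 ⊗ a2, dbr bracket3 a3 a1 = a1 ⊗ a3 - a3 ⊗ a1 &
      dbr bracket3 a3 a2 = - (a3 ⊗ a2)]
  /\ [/\ dbr bracket3 a1 a1 = 0, dbr bracket3 a1 a3 = 0,
         dbr bracket3 a2 a2 = 0 & dbr bracket3 a3 a3 = 0].
Proof.
have E i j : dbr bracket3 << i >> << j >> = bracket3_basis (i, j).
  by rewrite /dbr tensU [LHS]linextU.
by split; split; exact: E.
Qed.

End ThreeDimensional.

(* Main.v *)
Require Import Defs.
From HB Require Import structures.
From mathcomp Require Import all_boot all_order all_algebra.
From mathcomp Require Import finmap.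
From mathcomp.multinomials Require Import monalg.

Set Implicit Arguments.
Unset Strict Implicit.
Unset Printing Implicit Defensive.

Import GRing.Theory.
Local Open Scope ring_scope.

(* Let theta_k be the cyclic derivative of a word w, the sum of v u over the
   factorizations w = u x_k v.  The Leibniz rules make {a, -} a derivation with
   {a, x_c} = sum_i p theta_i(a) q, where {{x_i, x_c}} = sum p ⊗ q, so that it
   depends on a only through the theta_i(a), which vanish on commutators.
   The given double bracket is not skew, but for all i and j
     {{x_i, x_j}} + {{x_j, x_i}}^op = x_j ⊗ x_i - x_i ⊗ x_j,
   so the failure of skewness is the inner derivation by
     N_b = sum_j theta_j(b) x_j = sum_j x_j theta_j(b).
   Together with the symmetry of second cyclic derivatives this gives
     theta_k {a, b} = {a, theta_k b} - {b, theta_k a} + [theta_k a, N_b] + (terms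
   without second derivatives).  Both sides of (3) are derivations in c, and on
   generators the formula turns (3) into an identity of noncommutative polynomials
   in the x_i, theta_i(a) and theta_i(b). *)

(** * Identities in noncommuting variables *)

Inductive ncexpr :=
  | NCvar of nat | NCzero | NCone
  | NCopp of ncexpr | NCadd of ncexpr & ncexpr | NCmul of ncexpr & ncexpr.

(* The positive and negative monomials of an expanded expression. *)
Fixpoint nc_expand (e : ncexpr) : seq (seq nat) * seq (seq nat) :=
  match e with
  | NCvar i => ([:: [:: i]], [::])
  | NCzero => ([::], [::])
  | NCone => ([:: [::]], [::])
  | NCopp e => let p := nc_expand e in (p.2, p.1)
  | NCadd e f => let p := nc_expand e in let q := nc_expand f in
      (p.1 ++ q.1, p.2 ++ q.2)
  | NCmul e f => let p := nc_expand e in let q := nc_expand f in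
      ([seq m ++ n | m <- p.1, n <- q.1] ++ [seq m ++ n | m <- p.2, n <- q.2],
       [seq m ++ n | m <- p.1, n <- q.2] ++ [seq m ++ n | m <- p.2, n <- q.1])
  end.

Section NoncommutativeIdentities.
Variables (R : pzRingType) (l : seq R).

Fixpoint nc_eval (e : ncexpr) : R :=
  match e with
  | NCvar i => l`_i
  | NCzero => 0
  | NCone => 1
  | NCopp e => - nc_eval e
  | NCadd e f => nc_eval e + nc_eval f
  | NCmul e f => nc_eval e * nc_eval f
  end.

Definition nc_sum (s : seq (seq nat)) : R := \sum_(m <- s) \prod_(i <- m) l`_i.

Lemma nc_sum_cat s t : nc_sum (s ++ t) = nc_sum s + nc_sum t.
Proof. exact: big_cat. Qed.

Lemma nc_sum_mul s t : nc_sum [seq m ++ n | m <- s, n <- t] = nc_sum s * nc_sum t.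
Proof.
rewrite /nc_sum big_allpairs_dep mulr_suml; apply: eq_bigr => m _.
by rewrite mulr_sumr; apply: eq_bigr => n _; rewrite big_cat.
Qed.

Lemma nc_expandE e : nc_eval e = nc_sum (nc_expand e).1 - nc_sum (nc_expand e).2.
Proof.
elim: e => [i|||e IHe|e IHe f IHf|e IHe f IHf] /=.
- by rewrite /nc_sum !big_seq1 big_nil subr0.
- by rewrite /nc_sum big_nil subr0.
- by rewrite /nc_sum big_seq1 !big_nil subr0.
- by rewrite IHe opprB.
- by rewrite IHe IHf !nc_sum_cat opprD addrACA.
- rewrite IHe IHf !nc_sum_cat !nc_sum_mul mulrBl !mulrBr !opprD !opprK -!addrA.
  by rewrite [in LHS](addrA (- _)) [in LHS](addrC (- _ - _)).
Qed.

(** Moving the negative monomials across turns the identity into an equality of multisets of words,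
    so cancellation never has to be carried out. *)
Lemma nc_eq e f :
    perm_eq ((nc_expand e).1 ++ (nc_expand f).2) ((nc_expand f).1 ++ (nc_expand e).2) ->
  nc_eval e = nc_eval f.
Proof.
move=> ef; apply/eqP; rewrite !nc_expandE subr_eq addrAC eq_sym subr_eq eq_sym.
by rewrite -!nc_sum_cat; apply/eqP; exact: perm_big.
Qed.

End NoncommutativeIdentities.

(* Atoms are compared by unification, since the structure paths in their
   subterms may differ. *)
Ltac nc_index t l :=
  match l with
  | ?u :: _ => let _ := match goal with _ => unify t u end in constr:(0%N)
  | _ :: ?l' => let i := nc_index t l' in constr:(i.+1)
  end.

Ltac nc_atoms t l :=
  lazymatch t with
  | @Algebra.zero _ => l
  | @GRing.one _ => l
  | @Algebra.opp _ ?a => nc_atoms a l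
  | @Algebra.add _ ?a ?b => let l' := nc_atoms a l in nc_atoms b l'
  | @GRing.mul _ ?a ?b => let l' := nc_atoms a l in nc_atoms b l'
  | _ => match l with
         | _ => let _ := nc_index t l in l
         | _ => constr:(t :: l)
         end
  end.

Ltac nc_reify t l :=
  lazymatch t with
  | @Algebra.zero _ => constr:(NCzero)
  | @GRing.one _ => constr:(NCone)
  | @Algebra.opp _ ?a => let e := nc_reify a l in constr:(NCopp e)
  | @Algebra.add _ ?a ?b =>
      let e := nc_reify a l in let f := nc_reify b l in constr:(NCadd e f)
  | @GRing.mul _ ?a ?b =>
      let e := nc_reify a l in let f := nc_reify b l in constr:(NCmul e f)
  | _ => let i := nc_index t l in constr:(NCvar i)
  end.

(** Any subterm not headed by a ring operation is an atom, including multiples such as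
    [u *+ (i == k)]. Every use therefore first distributes or splits whatever must be seen inside
    such a subterm. *)
Ltac noncomm R :=
  lazymatch goal with
  | |- @eq _ ?s ?t =>
      let l := nc_atoms s (@nil (GRing.PzRing.sort R)) in
      let l := nc_atoms t l in
      let e := nc_reify s l in let f := nc_reify t l in
      apply: (@nc_eq R l e f); vm_compute; reflexivity
  end.

(** * Linear maps *)

Section LinearCombinations.
Variable F : fieldType.

Lemma mul_linl (A : algType F) c (x y z : A) :
  (c *: x + y) * z = c *: (x * z) + y * z.
Proof. by rewrite mulrDl scalerAl. Qed.

Lemma mul_linr (A : algType F) c (x y z : A) :
  z * (c *: x + y) = c *: (z * x) + z * y.
Proof. by rewrite mulrDr scalerAr. Qed.

Lemma lin_add (W : lmodType F) (c : F) (x y z t : W) :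
  c *: x + y + (c *: z + t) = c *: (x + z) + (y + t).
Proof. by rewrite scalerDr addrACA. Qed.

Lemma lin_opp (W : lmodType F) (c : F) (x y : W) : - (c *: x + y) = c *: (- x) - y.
Proof. by rewrite opprD scalerN. Qed.

Section LinearMap.
Variables (U V : lmodType F) (f : U -> V).
Hypothesis f_lin : linear f.

Lemma lin_fun0 : f 0 = 0.
Proof. by rewrite -[0 in LHS](addNr 0) -scaleN1r f_lin scaleN1r addNr. Qed.

Lemma lin_funD x y : f (x + y) = f x + f y.
Proof. by rewrite -[x in LHS]scale1r f_lin scale1r. Qed.

Lemma lin_funN x : f (- x) = - f x.
Proof. by rewrite -[- x]addr0 -scaleN1r f_lin scaleN1r lin_fun0 addr0. Qed.

Lemma lin_funB x y : f (x - y) = f x - f y.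
Proof. by rewrite lin_funD lin_funN. Qed.

End LinearMap.

Lemma lin_sum (W : lmodType F) (J : finType) c (G H : J -> W) :
  \sum_j (c *: G j + H j) = c *: (\sum_j G j) + \sum_j H j.
Proof. by rewrite big_split scaler_sumr. Qed.

End LinearCombinations.

(** Brings expressions to the shape [c *: u + v], so that the linear step of an induction over the
    algebra closes by the two induction hypotheses. *)
Definition linE := (mul_linl, mul_linr, lin_opp, lin_sum, lin_add).

(** * Leibniz extensions *)

Section Words.
Variables (F : fieldType) (I : choiceType) (A : algType F) (word : seq I -> A).
Hypothesis word1 : word [::] = 1.
Hypothesis word_cons : forall i w, word (i :: w) = word [:: i] * word w.
Hypothesis word_ind : forall P : A -> Prop, (forall w, P (word w)) ->
  (forall c x y, P x -> P y -> P (c *: x + y)) -> forall x, P x.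
Local Notation gen i := (word [:: i]).

Lemma word_free_ind (P : A -> Prop) :
    P 1 -> (forall i y, P y -> P (gen i * y)) ->
    (forall c x y, P x -> P y -> P (c *: x + y)) ->
  forall x, P x.
Proof.
move=> P1 PM PD; apply: word_ind => //.
by elim=> [|i w Pw]; [rewrite word1 | rewrite word_cons; exact: PM].
Qed.

Section CyclicDerivative.

(* [cyclic_word k w z] is the sum of [v z u] over the factorizations [w = u k v]. *)
Fixpoint cyclic_word (k : I) (w : seq I) (z : A) : A :=
  if w is i :: w' then
    (word w' * z) *+ (i == k) + cyclic_word k w' (z * gen i)
  else 0.

Variable T : I -> A -> A -> A.
Hypothesis T_linl : forall k z, linear (T k ^~ z).
Hypothesis T_word : forall k w z, T k (word w) z = cyclic_word k w z.

Lemma cyclic1 k z : T k 1 z = 0.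
Proof. by rewrite -word1 T_word. Qed.

Lemma cyclic_cons k i y z :
  T k (gen i * y) z = (y * z) *+ (i == k) + T k y (z * gen i).
Proof.
elim/word_ind: y => [w|c x y IHx IHy]; first by rewrite -word_cons !T_word.
by rewrite mul_linr !T_linl IHx IHy mul_linl mulrnDl scalerMnr lin_add.
Qed.

(** [T] is prescribed on words of its first argument only; linearity in the inserted element is
    inherited from the recursion on words. *)
Lemma cyclic_linr k a : linear (T k a).
Proof.
elim/word_free_ind: a => [|i a IHa|c x y IHx IHy] d u v.
- by rewrite !cyclic1 scaler0 addr0.
- by rewrite !cyclic_cons mul_linl mul_linr IHa mulrnDl scalerMnr lin_add.
- by rewrite !T_linl IHx IHy !scalerDr !scalerA (mulrC c d) addrACA.
Qed.

End CyclicDerivative.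

Section Bracket.
Variables (B : algType F) (tens : A -> A -> B).
Hypothesis tens_linl : forall z, linear (tens^~ z).
Hypothesis tens_linr : forall z, linear (tens z).
Hypothesis tensM : forall a b c d, tens a b * tens c d = tens (a * c) (b * d).
Hypothesis tens11 : tens 1 1 = 1.

Definition leibniz (E : A -> A -> B) :=
  (forall a b c, E a (b * c) = tens b 1 * E a c + E a b * tens 1 c) /\
  (forall a b c, E (a * b) c = tens 1 a * E b c + E a c * tens b 1).

Section Rules.
Variable E : A -> A -> B.
Hypothesis E_linl : forall z, linear (E^~ z).
Hypothesis E_linr : forall z, linear (E z).
Hypothesis E1r : forall a, E a 1 = 0.
Hypothesis E1l : forall j, E 1 (gen j) = 0.
Hypothesis E_consr : forall a j b,
  E a (gen j * b) = tens (gen j) 1 * E a b + E a (gen j) * tens 1 b.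
Hypothesis E_consl : forall i a j,
  E (gen i * a) (gen j) =
  tens 1 (gen i) * E a (gen j) + E (gen i) (gen j) * tens a 1.

Lemma mull_gen_of_cons a b j :
  E (a * b) (gen j) = tens 1 a * E b (gen j) + E a (gen j) * tens b 1.
Proof.
elim/word_free_ind: a => [|i a IHa|c x y IHx IHy].
- by rewrite mul1r tens11 mul1r E1l mul0r addr0.
- rewrite -mulrA !E_consl IHa mulrDr mulrDl !mulrA tensM mulr1 -!addrA.
  by rewrite -[_ * tens a 1 * _]mulrA tensM mulr1.
- by rewrite mul_linl !E_linl tens_linr !mul_linl lin_add IHx IHy.
Qed.

(** Induction on the argument being split extends the one-letter rules to products. The two rules
    are compatible because [tens u 1] and [tens 1 v] commute. *)
Lemma leibniz_of_cons : leibniz E.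
Proof.
split=> a b c.
  elim/word_free_ind: b => [|j b IHb|k x y IHx IHy].
  - by rewrite mul1r E1r mul0r addr0 tens11 mul1r.
  - rewrite -mulrA !E_consr IHb mulrDr mulrDl !mulrA tensM mulr1 -!addrA.
    by rewrite -[_ * tens 1 b * _]mulrA tensM mulr1.
  - by rewrite mul_linl !E_linr tens_linl !mul_linl lin_add IHx IHy.
elim/word_free_ind: c => [|j c IHc|k x y IHx IHy].
- by rewrite !E1r mulr0 mul0r addr0.
- rewrite !E_consr IHc mull_gen_of_cons !mulrDr !mulrDl !mulrA.
  rewrite !tensM !(mul1r, mulr1) addrACA; congr (_ + _ + (_ + _)).
  by rewrite -!mulrA !tensM !(mul1r, mulr1).
- by rewrite !E_linr !linE IHx IHy.
Qed.

End Rules.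

Section Leibniz.
Variable E : A -> A -> B.
Hypothesis leibE : leibniz E.

Lemma leibniz1r a : E a 1 = 0.
Proof.
have := leibE.1 a 1 1; rewrite mulr1 tens11 mul1r mulr1.
by move/eqP; rewrite -subr_eq0 opprD addNKr oppr_eq0 => /eqP.
Qed.

Lemma leibniz1l a : E 1 a = 0.
Proof.
have := leibE.2 1 1 a; rewrite mulr1 tens11 mul1r mulr1.
by move/eqP; rewrite -subr_eq0 opprD addNKr oppr_eq0 => /eqP.
Qed.

End Leibniz.

Lemma leibniz_unique (E E' : A -> A -> B) :
    (forall z, linear (E^~ z)) -> (forall z, linear (E z)) ->
    (forall z, linear (E'^~ z)) -> (forall z, linear (E' z)) ->
    leibniz E -> leibniz E' -> (forall i j, E (gen i) (gen j) = E' (gen i) (gen j)) ->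
  forall a b, E a b = E' a b.
Proof.
move=> El Er El' Er' lE lE' EE' a b.
have EE'_gen j : E a (gen j) = E' a (gen j).
  elim/word_free_ind: a => [|i a IHa|c x y IHx IHy].
  - by rewrite (leibniz1l lE) (leibniz1l lE').
  - by rewrite lE.2 lE'.2 IHa EE'.
  - by rewrite El El' IHx IHy.
elim/word_free_ind: b => [|j b IHb|c x y IHx IHy].
- by rewrite (leibniz1r lE) (leibniz1r lE').
- by rewrite lE.1 lE'.1 IHb EE'_gen.
- by rewrite Er Er' IHx IHy.
Qed.

Section Extension.
Variable bra : I -> I -> B.

(** The value forced by the second Leibniz rule when the second argument is a generator; [ext_word]
    then peels the second argument by the first rule. *)
Fixpoint ext_left (w : seq I) (j : I) : B :=
  if w is i :: w' then
    tens 1 (gen i) * ext_left w' j + bra i j * tens (word w') 1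
  else 0.

Fixpoint ext_word (w v : seq I) : B :=
  if v is j :: v' then
    tens (gen j) 1 * ext_word w v' + ext_left w j * tens 1 (word v')
  else 0.

Variable E : A -> A -> B.
Hypothesis E_linl : forall z, linear (E^~ z).
Hypothesis E_linr : forall z, linear (E z).
Hypothesis E_word : forall w v, E (word w) (word v) = ext_word w v.

Lemma ext_word_gen w j : E (word w) (gen j) = ext_left w j.
Proof. by rewrite E_word /= mulr0 add0r word1 tens11 mulr1. Qed.

Lemma ext_gen i j : E (gen i) (gen j) = bra i j.
Proof. by rewrite ext_word_gen /= mulr0 add0r word1 tens11 mulr1. Qed.

Lemma leibniz_ext_word : leibniz E.
Proof.
apply: leibniz_of_cons => // [a|j|a j b|i a j].
- elim/word_ind: a => [w|c x y IHx IHy]; first by rewrite -word1 E_word.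
  by rewrite E_linl IHx IHy scaler0 addr0.
- by rewrite -word1 ext_word_gen.
- elim/word_ind: a => [w|c x y IHx IHy]; last by rewrite !E_linl !linE IHx IHy.
  elim/word_ind: b => [v|c x y IHx IHy].
    by rewrite -word_cons ext_word_gen !E_word.
  by rewrite mul_linr !E_linr tens_linr !linE IHx IHy.
- elim/word_ind: a => [w|c x y IHx IHy].
    by rewrite ext_gen -word_cons !ext_word_gen.
  by rewrite mul_linr !E_linl tens_linl !linE IHx IHy.
Qed.

End Extension.
End Bracket.
End Words.

(** * Cyclic derivatives and derivations *)

Section Cyclic.
Variables (F : fieldType) (I : finType) (A : algType F) (gen : I -> A).
Hypothesis gen_ind : forall P : A -> Prop, P 1 ->
  (forall i y, P y -> P (gen i * y)) ->
  (forall c x y, P x -> P y -> P (c *: x + y)) -> forall x, P x.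
Variable T : I -> A -> A -> A.
Hypothesis T_linl : forall k z, linear (T k ^~ z).
Hypothesis T_linr : forall k a, linear (T k a).
Hypothesis T1 : forall k z, T k 1 z = 0.
Hypothesis T_cons : forall k i y z,
  T k (gen i * y) z = (y * z) *+ (i == k) + T k y (z * gen i).

Local Notation theta k a := (T k a 1).

Definition derivation (D : A -> A) :=
  linear D /\ forall x y, D (x * y) = D x * y + x * D y.

Lemma derivation1 D : derivation D -> D 1 = 0.
Proof.
case=> _ DM; have := DM 1 1; rewrite !mulr1 mul1r.
by move/eqP; rewrite -subr_eq0 opprD addNKr oppr_eq0 => /eqP.
Qed.

Lemma derivation_eq D D' : derivation D -> derivation D' ->
  (forall i, D (gen i) = D' (gen i)) -> forall x, D x = D' x.
Proof.
move=> dD dD' DD'; elim/gen_ind => [|i y IHy|c x y IHx IHy].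
- by rewrite !derivation1.
- by rewrite dD.2 dD'.2 DD' IHy.
- by rewrite dD.1 dD'.1 IHx IHy.
Qed.

Lemma derivation_inner n : derivation (fun x => x * n - n * x).
Proof.
split=> [c x y|x y]; first by rewrite !linE.
by noncomm A.
Qed.

Lemma derivationB D D' : derivation D -> derivation D' ->
  derivation (fun x => D x - D' x).
Proof.
move=> [lD DM] [lD' DM']; split=> [c x y|x y]; first by rewrite lD lD' !linE.
by rewrite DM DM' mulrBl mulrBr opprD addrACA.
Qed.

Lemma derivation_comm D D' : derivation D -> derivation D' ->
  derivation (fun x => D (D' x) - D' (D x)).
Proof.
move=> [lD DM] [lD' DM']; split=> [c x y|x y].
  by rewrite lD lD' lD lD' !linE.
rewrite DM DM' (lin_funD lD) (lin_funD lD') !DM !DM'.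
by noncomm A.
Qed.

(** The inductive step for all sums over cyclic derivatives: prepending a letter adds one term and
    moves that letter behind [z]. This is why the later inductions keep [z] general. *)
Lemma T_cons_sum (W : zmodType) (f : I -> A -> W) m a z :
    (forall i x y, f i (x + y) = f i x + f i y) ->
  \sum_i f i (T i (gen m * a) z) = f m (a * z) + \sum_i f i (T i a (z * gen m)).
Proof.
move=> fD; have f0 i : f i 0 = 0 by apply: (addrI (f i 0)); rewrite -fD !addr0.
rewrite (eq_bigr (fun i => f i ((a * z) *+ (m == i)) + f i (T i a (z * gen m)))).
  rewrite big_split (bigD1 m) //= eqxx big1 ?addr0 // => i /negPf.
  by rewrite eq_sym => ->.
by move=> i _; rewrite T_cons fD.
Qed.

Lemma T_lin_sum (W : lmodType F) (f : I -> A -> W) c x y z :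
    (forall i, linear (f i)) ->
  \sum_i f i (T i (c *: x + y) z) =
  c *: (\sum_i f i (T i x z)) + \sum_i f i (T i y z).
Proof. by move=> fl; rewrite -lin_sum; apply: eq_bigr => i _; rewrite T_linl fl. Qed.

Lemma T_gen k i z : T k (gen i) z = z *+ (i == k).
Proof. by rewrite -[gen i]mulr1 T_cons T1 addr0 mul1r. Qed.

(** The deleted letter lies in [a] or in [b]; the other factor then becomes part of what is inserted
    when the word is rotated. *)
Lemma T_mul k a b z : T k (a * b) z = T k a (b * z) + T k b (z * a).
Proof.
elim/gen_ind: a z => [|i a IHa|c x y IHx IHy] z.
- by rewrite mul1r mulr1 T1 add0r.
- by rewrite -mulrA !T_cons IHa !mulrA addrA.
- by rewrite !mul_linl mul_linr !T_linl T_linr lin_add IHx IHy.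
Qed.

Lemma theta_mul k a b : theta k (a * b) = T k a b + T k b a.
Proof. by rewrite T_mul mulr1 mul1r. Qed.

Lemma theta_commutator k a b : theta k (a * b - b * a) = 0.
Proof. by rewrite (lin_funB (T_linl k 1)) !theta_mul; noncomm A. Qed.

(* With [z = 1] this expresses the symmetry of second cyclic derivatives. *)
Lemma derivation_T D k a z : derivation D ->
  \sum_i T k (T i a z) (D (gen i)) + T k a (D z) = D (T k a z) + T k z (D a).
Proof.
move=> dD; have [lD DM] := dD.
elim/gen_ind: a z => [|m a IHa|c x y IHx IHy] z.
- rewrite !T1 (lin_fun0 lD) derivation1 // (lin_fun0 (T_linr k z)) big1 => [|i _].
    by rewrite addr0.
  by rewrite T1 (lin_fun0 (T_linl k _)).
- rewrite (T_cons_sum (f := fun i u => T k u (D (gen i)))); last first.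
    by move=> i; exact: (lin_funD (T_linl k _)).
  have {}IHa := IHa (z * gen m).
  have -> : \sum_i T k (T i a (z * gen m)) (D (gen i)) =
      D (T k a (z * gen m)) + T k (z * gen m) (D a) - T k a (D (z * gen m)).
    by rewrite -IHa addrK.
  rewrite !T_cons !T_mul !DM !T_gen !(lin_funD lD) !(lin_funD (T_linr k _)).
  have -> : D (a * z *+ (m == k)) = (D a * z) *+ (m == k) + (a * D z) *+ (m == k).
    by case: (m == k); rewrite ?mulr1n ?DM // !mulr0n (lin_fun0 lD) addr0.
  by noncomm A.
- rewrite (T_lin_sum (f := fun i u => T k u (D (gen i)))); last by [].
  by rewrite !T_linl !lD T_linr !lin_add IHx IHy.
Qed.

(** Both sides sum over pairs of distinct positions in the cyclic word [a], carrying letters x_k and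
    x_i: the word is cut open at x_k, which is deleted, and x_i is replaced by its image under
    [D]. *)
Lemma derivation_theta D k a : derivation D ->
  \sum_i T k (theta i a) (D (gen i)) = D (theta k a).
Proof.
move=> dD; have := derivation_T k a 1 dD.
by rewrite derivation1 // (lin_fun0 (T_linr k a)) T1 !addr0.
Qed.

(** Modulo commutators a word may be rotated until the letter replaced by its image under [D] comes
    first. [S] is arbitrary so as to serve both for the kernel of a cyclic derivative and for the
    span of commutators. *)
Lemma derivation_mod_commutator (S : A -> Prop) D a z :
    (forall c x y, S x -> S y -> S (c *: x + y)) ->
    (forall x y, S (x * y - y * x)) -> derivation D ->
  S (z * D a - \sum_i D (gen i) * T i a z).
Proof.
move=> S_lin S_comm dD; have [lD DM] := dD.
have S0 : S 0 by rewrite -[0](subrr (1 * 1)).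
have SD x y : S x -> S y -> S (x + y) by rewrite -{2}[x]scale1r; exact: S_lin.
elim/gen_ind: a z => [|m a IHa|c x y IHx IHy] z.
- rewrite derivation1 // mulr0 big1 ?subrr // => i _.
  by rewrite T1 mulr0.
- rewrite (T_cons_sum (f := fun i u => D (gen i) * u)); last first.
    by move=> *; rewrite mulrDr.
  have := SD _ _ (S_comm z (D (gen m) * a)) (IHa (z * gen m)).
  by congr S; rewrite DM; noncomm A.
- have := S_lin c _ _ (IHx z) (IHy z); congr S.
  rewrite lD mul_linr (T_lin_sum (f := fun i u => D (gen i) * u)).
    by rewrite !linE.
  by move=> ? ? ? ?; rewrite mul_linr.
Qed.

(** Each occurrence of a letter contributes the difference of two consecutive rotations, and these
    telescope from [a * z] to [z * a]. *)
Lemma sum_theta a z :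
  \sum_i gen i * T i a z - \sum_i T i a z * gen i = a * z - z * a.
Proof.
elim/gen_ind: a z => [|m a IHa|c x y IHx IHy] z.
- by rewrite !big1 ?mul1r ?mulr1 ?subrr // => i _; rewrite T1 ?mulr0 ?mul0r.
- rewrite (T_cons_sum (f := fun i u => gen i * u)); last by move=> *; rewrite mulrDr.
  rewrite (T_cons_sum (f := fun i u => u * gen i)); last by move=> *; rewrite mulrDl.
  have /eqP := IHa (z * gen m); rewrite subr_eq => /eqP ->.
  by noncomm A.
- rewrite (T_lin_sum (f := fun i u => gen i * u)); last first.
    by move=> ? ? ? ?; rewrite mul_linr.
  rewrite (T_lin_sum (f := fun i u => u * gen i)); last first.
    by move=> ? ? ? ?; rewrite mul_linl.
  by rewrite !linE IHx IHy.
Qed.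

(** Applied to the monomials of the bracket, with [a] and [b] cyclic derivatives: the first two
    terms give second derivatives, the last two come from deleting one of the visible generators. *)
Lemma theta_mul4 k p q a b :
  theta k (gen p * a * gen q * b) =
  T k a (gen q * b * gen p) + T k b (gen p * a * gen q) +
  ((a * gen q * b) *+ (p == k) + (b * gen p * a) *+ (q == k)).
Proof.
rewrite -!mulrA T_cons T_mul T_cons !(mulrA, mulr1, mul1r).
by noncomm A.
Qed.

(** * The single bracket on three generators *)

Section ThreeGenerators.
Variables x y z : I.
Hypothesis xyz_uniq : uniq [:: x; y; z].
Hypothesis xyz_all : forall i, i \in [:: x; y; z].
Variable H : A -> A -> A.
Hypothesis H_der : forall a, derivation (H a).
Hypothesis Hx : forall a, H a (gen x) =
  gen x * theta y a * gen y + gen x * theta z a * gen z - gen z * theta z a * gen x.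
Hypothesis Hy : forall a, H a (gen y) =
  - (gen x * theta x a * gen y) - gen z * theta z a * gen y.
Hypothesis Hz : forall a, H a (gen z) = gen z * theta y a * gen y.

Lemma sum3 (f : I -> A) : \sum_i f i = f x + f y + f z.
Proof.
have enumI : perm_eq (enum I) [:: x; y; z].
  by apply: uniq_perm => [||i]; rewrite ?enum_uniq ?mem_enum ?xyz_all.
by rewrite -big_enum (perm_big _ enumI) !big_cons big_nil /= addr0 addrA.
Qed.

(** The element N_a, whose inner derivation measures the failure of skewness. *)
Definition nabla a := theta x a * gen x + theta y a * gen y + theta z a * gen z.

Lemma nablaE a : nabla a = gen x * theta x a + gen y * theta y a + gen z * theta z a.
Proof.
have /eqP := sum_theta a 1; rewrite mulr1 mul1r subrr subr_eq0 !sum3.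
by move/eqP.
Qed.

(** By [theta_mul4], second derivatives of [b] add up to [H a (theta k b)] and those of [a] to the
    image of [theta k a] under u -> [u, N_b] - [H b u]. The explicit terms come from deleting a
    generator in each of the six bracket monomials. *)
Lemma theta_H k a b : theta k (H a b) =
  H a (theta k b) - H b (theta k a) + (theta k a * nabla b - nabla b * theta k a)
  + (- ((theta x a * gen y * theta y b) *+ (x == k)
        + (theta y b * gen x * theta x a) *+ (y == k))
     + ((theta y a * gen y * theta x b) *+ (x == k)
        + (theta x b * gen x * theta y a) *+ (y == k))
     + ((theta y a * gen y * theta z b) *+ (z == k)
        + (theta z b * gen z * theta y a) *+ (y == k))
     + ((theta z a * gen z * theta x b) *+ (x == k)
        + (theta x b * gen x * theta z a) *+ (z == k))
     - ((theta z a * gen x * theta x b) *+ (z == k)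
        + (theta x b * gen z * theta z a) *+ (x == k))
     - ((theta z a * gen y * theta y b) *+ (z == k)
        + (theta y b * gen z * theta z a) *+ (y == k))).
Proof.
(* The two arguments of [theta k] agree modulo commutators, which [theta k] kills. *)
have -> : theta k (H a b) = theta k (\sum_i H a (gen i) * theta i b).
  apply/eqP; rewrite -subr_eq0 -(lin_funB (T_linl k 1)); apply/eqP.
  rewrite -[H a b]mul1r.
  apply: (derivation_mod_commutator (S := fun u => theta k u = 0)) => //.
  - by move=> c u v u0 v0; rewrite T_linl u0 v0 scaler0 addr0.
  - exact: theta_commutator.
rewrite sum3 Hx Hy Hz.
rewrite -(derivation_theta k b (H_der a)) sum3 Hx Hy Hz.
(* The map u -> [u, N_b] - [H b u] is a derivation, so [derivation_theta] expresses it on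
   [theta k a] through its values on generators. *)
have -> : theta k a * nabla b - nabla b * theta k a = H b (theta k a) +
    \sum_i T k (theta i a) ((gen i * nabla b - nabla b * gen i) - H b (gen i)).
  rewrite (derivation_theta k a (derivationB (derivation_inner (nabla b)) (H_der b))).
  by noncomm A.
(* Either form of [nabla b] is used where its terms cancel against brackets. *)
have E u : u * nabla b - nabla b * u =
    u * nabla b - (gen x * theta x b + gen y * theta y b + gen z * theta z b) * u.
  by rewrite {2}nablaE.
rewrite sum3 !E /nabla Hx Hy Hz.
rewrite !(mulrDl, mulrDr, mulNr, mulrN, mulrA, opprD, opprK).
rewrite !(lin_funD (T_linl k _), lin_funD (T_linr k _), lin_funN (T_linl k _),
  lin_funN (T_linr k _)).
rewrite !theta_mul4.
by noncomm A.
Qed.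

Lemma theta_Hx a b : theta x (H a b) =
  H a (theta x b) - H b (theta x a) + (theta x a * nabla b - nabla b * theta x a)
  - theta x a * gen y * theta y b + theta y a * gen y * theta x b
  + theta z a * gen z * theta x b - theta x b * gen z * theta z a.
Proof.
move: xyz_uniq; rewrite /= !inE negb_or andbT => /andP[/andP[nxy nxz] nyz].
rewrite theta_H eqxx ![_ == x]eq_sym (negPf nxy) (negPf nxz) !mulr0n !mulr1n.
by noncomm A.
Qed.

Lemma theta_Hy a b : theta y (H a b) =
  H a (theta y b) - H b (theta y a) + (theta y a * nabla b - nabla b * theta y a)
  - theta y b * gen x * theta x a + theta x b * gen x * theta y a
  + theta z b * gen z * theta y a - theta y b * gen z * theta z a.
Proof.
move: xyz_uniq; rewrite /= !inE negb_or andbT => /andP[/andP[nxy nxz] nyz].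
rewrite theta_H eqxx ![z == y]eq_sym (negPf nxy) (negPf nyz) !mulr0n !mulr1n.
by noncomm A.
Qed.

Lemma theta_Hz a b : theta z (H a b) =
  H a (theta z b) - H b (theta z a) + (theta z a * nabla b - nabla b * theta z a)
  + theta y a * gen y * theta z b - theta z a * gen x * theta x b
  + theta x b * gen x * theta z a - theta z a * gen y * theta y b.
Proof.
move: xyz_uniq; rewrite /= !inE negb_or andbT => /andP[/andP[nxy nxz] nyz].
rewrite theta_H eqxx (negPf nxz) (negPf nyz) !mulr0n !mulr1n.
by noncomm A.
Qed.

(** Both sides are derivations in [c]. On generators, the terms [H a (theta i b)] and
    [H b (theta i a)] produced by the derivation rule match those supplied by [theta_H], leaving an
    identity of polynomials. *)
Lemma H_jacobi a b c : H a (H b c) - H b (H a c) = H (H a b) c.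
Proof.
have HD d u v : H d (u + v) = H d u + H d v by exact: (lin_funD (H_der d).1).
have HN d u : H d (- u) = - H d u by exact: (lin_funN (H_der d).1).
have HM d u v : H d (u * v) = H d u * v + u * H d v by exact: (H_der d).2.
(* The reverse of the choice made in [theta_H]: generators come first in N_b where it follows [u],
   and last where it precedes [u]. *)
have EN u : u * nabla b - nabla b * u =
    u * (gen x * theta x b + gen y * theta y b + gen z * theta z b) - nabla b * u.
  by rewrite {1}nablaE.
apply: (derivation_eq (derivation_comm (H_der a) (H_der b)) (H_der _)) => i.
have := xyz_all i; rewrite !inE => /or3P[] /eqP ->.
- rewrite !Hx theta_Hy theta_Hz !EN /nabla !(HD, HN, HM, Hx, Hy, Hz).
  by noncomm A.
- rewrite !Hy theta_Hx theta_Hz !EN /nabla !(HD, HN, HM, Hx, Hy, Hz).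
  by noncomm A.
- rewrite !Hz theta_Hy !EN /nabla !(HD, HN, HM, Hx, Hy, Hz).
  by noncomm A.
Qed.

Lemma H_skew (S : A -> Prop) a b :
    (forall c x y, S x -> S y -> S (c *: x + y)) ->
    (forall x y, S (x * y - y * x)) ->
  S (H a b + H b a).
Proof.
move=> S_lin S_comm.
have SD u v : S u -> S v -> S (u + v) by rewrite -{2}[u]scale1r; exact: S_lin.
have Sab := derivation_mod_commutator b 1 S_lin S_comm (H_der a).
have Sba := derivation_mod_commutator a 1 S_lin S_comm (H_der b).
rewrite !mul1r !sum3 !Hx !Hy !Hz in Sab Sba.
suff : S ((\sum_i H a (gen i) * theta i b) + \sum_i H b (gen i) * theta i a).
  rewrite !sum3 !Hx !Hy !Hz => Ssum.
  by have := SD _ _ (SD _ _ Sab Sba) Ssum; congr S; noncomm A.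
rewrite !sum3 !Hx !Hy !Hz.
set a0 := theta x a; set a1 := theta y a; set a2 := theta z a.
set b0 := theta x b; set b1 := theta y b; set b2 := theta z b.
pose nb := gen x * b0 + gen y * b1 + gen z * b2.
pose com (u v : A) := u * v - v * u.
have Scom u v : S (com u v) by exact: S_comm.
(* [C1] and [C2] rotate each of the twelve monomials so that its cyclic derivative of [a] comes
   first. With a_i, b_j for the cyclic derivatives, what is left is the sum over i, j of a_i x_i b_j
   x_j - a_i x_j b_j x_i, that is N_a N_b - sum_i a_i N_b x_i. This equals [C3], since N_a is also
   the sum of the x_i a_i. *)
pose C1 := com (gen x) (a1 * gen y * b0) + com (gen x) (a2 * gen z * b0)
  + com (a2 * gen x * b0) (gen z) + com (a0 * gen y * b1) (gen x)
  + com (a2 * gen y * b1) (gen z) + com (gen z) (a1 * gen y * b2).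
pose C2 := com (gen x * b1 * gen y) a0 + com (gen x * b2 * gen z) a0
  + com a0 (gen z * b2 * gen x) + com a1 (gen x * b0 * gen y)
  + com a1 (gen z * b2 * gen y) + com (gen z * b1 * gen y) a2.
pose C3 := com (gen x) (a0 * nb) + com (gen y) (a1 * nb) + com (gen z) (a2 * nb).
have : S (C1 + C2 + C3) by rewrite /C1 /C2 /C3; do ![exact: Scom | apply/SD].
congr S; apply/eqP; rewrite -subr_eq0; apply/eqP.
transitivity ((gen x * a0 + gen y * a1 + gen z * a2) * nb - nabla a * nabla b).
  by rewrite /C1 /C2 /C3 /com /nb /nabla -/a0 -/a1 -/a2 -/b0 -/b1 -/b2; noncomm A.
by rewrite /nb -(nablaE a) -(nablaE b) subrr.
Qed.

End ThreeGenerators.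

(** * From the double bracket to the single bracket *)

Section SingleBracket.
Variables (B : algType F) (tens : A -> A -> B) (mu : B -> A).
Hypothesis tens_linl : forall z, linear (tens^~ z).
Hypothesis tensM : forall a b c d, tens a b * tens c d = tens (a * c) (b * d).
Hypothesis tens11 : tens 1 1 = 1.
Hypothesis tens_ind : forall P : B -> Prop, (forall a b, P (tens a b)) ->
  (forall c x y, P x -> P y -> P (c *: x + y)) -> forall x, P x.
Hypothesis mu_lin : linear mu.
Hypothesis mu_tens : forall a b, mu (tens a b) = a * b.
Variable E : A -> A -> B.
Hypothesis E_linl : forall z, linear (E^~ z).
Hypothesis E_linr : forall z, linear (E z).
Hypothesis leibE : leibniz tens E.

(** The first Leibniz rule multiplies on the outer sides of the two tensor factors, and such
    multiplications pass through [mu]. *)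
Lemma single_bracket_derivation a : derivation (fun b => mu (E a b)).
Proof.
split=> [c u v|u v]; first by rewrite E_linr mu_lin.
rewrite leibE.1 (lin_funD mu_lin) addrC; congr (_ + _).
  elim/tens_ind: (E a u) => [p q|c p q IHp IHq].
    by rewrite tensM !mu_tens mulr1 mulrA.
  by rewrite mul_linl !mu_lin mul_linl IHp IHq.
elim/tens_ind: (E a v) => [p q|c p q IHp IHq].
  by rewrite tensM !mu_tens mul1r mulrA.
by rewrite mul_linr !mu_lin mul_linr IHp IHq.
Qed.

(** Multiplying by [tens z 1] inserts [z] between the tensor factors. For a word u x_i v, the second
    Leibniz rule turns a summand p ⊗ q of the bracket of x_i with [b] into p v ⊗ u q, so that p v z
    u q results, and v z u is the summand of [T i a z]. *)
Lemma single_bracket_sum a b z :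
  mu (E a b * tens z 1) = \sum_i mu (E (gen i) b * tens (T i a z) 1).
Proof.
pose f i u := mu (E (gen i) b * tens u 1).
have f_lin i : linear (f i).
  by move=> c u v; rewrite /f tens_linl mul_linr mu_lin.
rewrite -[RHS]/(\sum_i f i (T i a z)); elim/gen_ind: a z => [|i a IHa|c x y IHx IHy] z.
- rewrite (leibniz1l tens11 leibE) mul0r (lin_fun0 mu_lin) big1 // => i _.
  by rewrite T1 (lin_fun0 (f_lin i)).
- rewrite (T_cons_sum (f := f)); last by move=> j; exact: (lin_funD (f_lin j)).
  rewrite -IHa leibE.2 mulrDl (lin_funD mu_lin) addrC; congr (_ + _).
    by rewrite -mulrA tensM mulr1.
  elim/tens_ind: (E a b) => [p q|c p q IHp IHq].
    by rewrite !tensM !mu_tens !mul1r !mulr1 !mulrA.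
  by rewrite mul_linr !mul_linl !mu_lin IHp IHq.
- by rewrite E_linl mul_linl mu_lin (T_lin_sum (f := f)) // IHx IHy.
Qed.

Lemma single_bracket_gens a b :
  mu (E a b) = \sum_i mu (E (gen i) b * tens (theta i a) 1).
Proof. by rewrite -single_bracket_sum tens11 mulr1. Qed.

Variables x y z : I.
Hypothesis xyz_uniq : uniq [:: x; y; z].
Hypothesis xyz_all : forall i, i \in [:: x; y; z].
Local Notation ten i j := (tens (gen i) (gen j)).
Hypothesis Exx : E (gen x) (gen x) = 0.
Hypothesis Exy : E (gen x) (gen y) = - ten x y.
Hypothesis Exz : E (gen x) (gen z) = 0.
Hypothesis Eyx : E (gen y) (gen x) = ten x y.
Hypothesis Eyy : E (gen y) (gen y) = 0.
Hypothesis Eyz : E (gen y) (gen z) = ten z y.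
Hypothesis Ezx : E (gen z) (gen x) = ten x z - ten z x.
Hypothesis Ezy : E (gen z) (gen y) = - ten z y.
Hypothesis Ezz : E (gen z) (gen z) = 0.

Local Notation H a b := (mu (E a b)).

Let muD := lin_funD mu_lin.
Let muN := lin_funN mu_lin.
Let mu0 := lin_fun0 mu_lin.

Lemma single_x a : H a (gen x) =
  gen x * theta y a * gen y + gen x * theta z a * gen z - gen z * theta z a * gen x.
Proof.
rewrite single_bracket_gens (sum3 xyz_uniq xyz_all) Exx Eyx Ezx.
by rewrite mul0r mulrBl !(muD, muN, mu0) !tensM !mu_tens !mulr1 add0r addrA.
Qed.

Lemma single_y a : H a (gen y) =
  - (gen x * theta x a * gen y) - gen z * theta z a * gen y.
Proof.
rewrite single_bracket_gens (sum3 xyz_uniq xyz_all) Exy Eyy Ezy.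
by rewrite mul0r !mulNr !(muD, muN, mu0) !tensM !mu_tens !mulr1 addr0.
Qed.

Lemma single_z a : H a (gen z) = gen z * theta y a * gen y.
Proof.
rewrite single_bracket_gens (sum3 xyz_uniq xyz_all) Exz Eyz Ezz.
by rewrite !mul0r !mu0 !tensM !mu_tens !mulr1 addr0 add0r.
Qed.

Lemma three_generator_poisson (S : A -> Prop) :
    (forall c x y, S x -> S y -> S (c *: x + y)) ->
    (forall x y, S (x * y - y * x)) ->
  (forall a b c, H a (H b c) - H b (H a c) = H (H a b) c) /\
  (forall a b, S (H a b + H b a)).
Proof.
move=> S_lin S_comm; split=> [a b c|a b].
  exact: (H_jacobi xyz_uniq xyz_all single_bracket_derivation single_x single_y
    single_z).
exact: (H_skew xyz_uniq xyz_all single_bracket_derivation single_x single_y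
  single_z).
Qed.

End SingleBracket.
End Cyclic.

(** * The free algebra *)

Section MonoidAlgebra.
Variables (R : comNzRingType) (M : monomType).

Lemma malg_scaleAr (c : R) (x y : {malg R[M]}) : c *: (x * y) = x * (c *: y).
Proof.
apply/malgP => k; rewrite mcoeffZ (mcoeffMlw _ (fsubset_refl _) (fsubset_refl _)).
rewrite (mcoeffMlw _ (fsubset_refl _) (msuppZ_le c y)) mulr_sumr.
apply: eq_bigr => k1 _; rewrite mulr_sumr; apply: eq_bigr => k2 _.
by rewrite mcoeffZ mulrnAr mulrCA.
Qed.

(* The canonical algebra instance of [malg] exists only over commutative monoids. *)
Definition malg_algebra : algType R :=
  HB.pack_for (algType R) (malg M R)
    (GRing.Lalgebra_isAlgebra.Build R (malg M R) malg_scaleAr).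

End MonoidAlgebra.

Section FreeAlgebra.
Variables (F : fieldType) (I : choiceType).
Local Notation A := (malg_algebra F {fmonom I}).
Local Notation AA := (malg_algebra F ({fmonom I} * {fmonom I})%type).

Definition fword (w : seq I) : A := << FMonom w >>.

Lemma fword1 : fword [::] = 1.
Proof. by rewrite /fword -fmoneE. Qed.

Lemma fword_cons i w : fword (i :: w) = fword [:: i] * fword w.
Proof.
rewrite /fword malgM_def fgmulUU mulr1; congr << _ >>.
by apply/eqP; rewrite fmP fmM.
Qed.

Lemma fword_ind (P : A -> Prop) :
    (forall w, P (fword w)) -> (forall c x y, P x -> P y -> P (c *: x + y)) ->
  forall x, P x.
Proof.
move=> PU PD x.
have P0 : P 0 by have := PD (-1) _ _ (PU [::]) (PU [::]); rewrite scaleN1r addNr.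
rewrite [x]monalgE; elim/big_ind: _ => // [y z Py Pz|[w] _].
  by rewrite -[y]scale1r; exact: PD.
by rewrite malgUZ -[_ *: _]addr0; exact: PD (PU w) P0.
Qed.

Lemma incl_gen i : incl F I << i >> = fword [:: i].
Proof. by rewrite /fword -fmuE; exact: linextU. Qed.

(** Retyped over [malg_algebra], as are [fincl2] and [fdbr], so that the results for an abstract
    [algType] apply. *)
Definition ftens : A -> A -> AA := @tens F {fmonom I} {fmonom I}.

Lemma ftens11 : ftens 1 1 = 1.
Proof. exact: tensU. Qed.

Lemma ftens_linl z : linear (ftens^~ z).
Proof. exact: tens_linearl. Qed.

Lemma ftens_linr z : linear (ftens z).
Proof. exact: tens_linearr. Qed.

Lemma ftensM a b c d : ftens a b * ftens c d = ftens (a * c) (b * d).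
Proof. exact: tensM. Qed.

Definition fincl2 : {malg F[(I * I)%type]} -> AA := incl2 F I.

Lemma fincl2_lin : linear fincl2.
Proof. exact: linearP. Qed.

Lemma fincl2U i j : fincl2 (<< i >> ⊗ << j >>) = ftens (fword [:: i]) (fword [:: j]).
Proof. by rewrite /fincl2 tensU [LHS]linextU !incl_gen. Qed.

Lemma ftens_ind (P : AA -> Prop) :
    (forall a b, P (ftens a b)) -> (forall c x y, P x -> P y -> P (c *: x + y)) ->
  forall x, P x.
Proof.
move=> PT PD x.
have P0 : P 0 by have := PD (-1) _ _ (PT 1 1) (PT 1 1); rewrite scaleN1r addNr.
rewrite [x]monalgE; elim/big_ind: _ => // [y z Py Pz|[k l] _].
  by rewrite -[y]scale1r; exact: PD.
by rewrite malgUZ -tensU -[_ *: _]addr0; exact: PD (PT _ _) P0.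
Qed.

Definition cyclic (k : I) (a z : A) : A :=
  linext (fun w : {fmonom I} => cyclic_word fword k w z) a.

Lemma cyclic_linl k z : linear (cyclic k ^~ z).
Proof. exact: linext_is_linear. Qed.

Lemma cyclic_fword k w z : cyclic k (fword w) z = cyclic_word fword k w z.
Proof. exact: linextU. Qed.

Definition fdbr (E : double_bracket F {fmonom I}) : A -> A -> AA := dbr E.

Lemma fdbr_linl E z : linear ((fdbr E)^~ z).
Proof. by move=> c x y; rewrite /fdbr /dbr tens_linearl linearP. Qed.

Lemma fdbr_linr E z : linear (fdbr E z).
Proof. by move=> c x y; rewrite /fdbr /dbr tens_linearr linearP. Qed.

Lemma fdbr_leibniz E : leibniz ftens (fdbr E) <-> double_leibniz E.
Proof. by []. Qed.

Section Extension.
Variable D : double_bracket F I.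

Definition free_bracket (i j : I) : AA := fincl2 (dbr D << i >> << j >>).

Definition leibniz_ext : double_bracket F {fmonom I} :=
  linext (fun p : ({fmonom I} * {fmonom I})%type =>
    ext_word fword ftens free_bracket p.1 p.2).

Lemma leibniz_ext_fword w v :
  fdbr leibniz_ext (fword w) (fword v) = ext_word fword ftens free_bracket w v.
Proof. by rewrite /fdbr /dbr tensU [LHS]linextU. Qed.

Lemma leibniz_ext_leibniz : leibniz ftens (fdbr leibniz_ext).
Proof.
exact: (leibniz_ext_word fword1 fword_cons fword_ind ftens_linl ftens_linr
  ftensM ftens11 (fdbr_linl _) (fdbr_linr _) leibniz_ext_fword).
Qed.

Lemma leibniz_ext_gen i j :
  fdbr leibniz_ext (fword [:: i]) (fword [:: j]) = free_bracket i j.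
Proof. exact: (ext_gen fword1 ftens11 leibniz_ext_fword). Qed.

Lemma leibniz_ext_extension : leibniz_extension D leibniz_ext.
Proof.
split; last by apply/fdbr_leibniz; exact: leibniz_ext_leibniz.
move=> u v.
(* The bracket of included vectors is bilinear, hence comes from a linear map on the tensor square
   of V; comparing it with [incl2 F I \o D] on basis pairs is then enough. *)
have [||f [fE _]] := @tens_universal F I I {malg F[({fmonom I} * {fmonom I})%type]}
  (fun u v => dbr leibniz_ext (incl F I u) (incl F I v)).
- by move=> w c x y; rewrite /dbr linearP tens_linearl linearP.
- by move=> w c x y; rewrite /dbr linearP tens_linearr linearP.
rewrite -fE; apply: (@linext_unique _ _ _ f (incl2 F I \o D)) => -[i j] /=.
rewrite -[in LHS]tensU fE !incl_gen -[in RHS]tensU.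
exact: leibniz_ext_gen.
Qed.

Lemma leibniz_extension_unique E : leibniz_extension D E -> E =1 leibniz_ext.
Proof.
case=> ED lE; apply: linext_unique => -[[w] [v]]; rewrite -tensU.
apply: (leibniz_unique fword1 fword_cons fword_ind ftens11 (fdbr_linl E) (fdbr_linr E)
  (fdbr_linl leibniz_ext) (fdbr_linr leibniz_ext) lE leibniz_ext_leibniz) => i j.
by rewrite leibniz_ext_gen /free_bracket /fincl2 -ED !incl_gen.
Qed.

End Extension.
End FreeAlgebra.

(** * Linear combinations of commutators *)

Section CommutatorSpan.
Variable F : fieldType.

Definition glue (T : Type) n m (f : 'I_n -> T) (g : 'I_m -> T) (i : 'I_(n + m)) :=
  match split i with inl j => f j | inr j => g j end.

Lemma commutator_sum_lin (A : algType F) (c : F) n m (a : 'I_n -> F) (b : 'I_m -> F)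
    (u v : 'I_n -> A) (s t : 'I_m -> A) :
  c *: (\sum_(i < n) a i *: (u i * v i - v i * u i)) +
    \sum_(i < m) b i *: (s i * t i - t i * s i) =
  \sum_(i < n + m) glue (fun j => c * a j) b i *:
    (glue u s i * glue v t i - glue v t i * glue u s i).
Proof.
rewrite big_split_ord /= scaler_sumr; congr (_ + _); apply: eq_bigr => i _.
  by rewrite /glue -[lshift m i]/(unsplit (inl i)) unsplitK scalerA.
by rewrite /glue -[rshift n i]/(unsplit (inr i)) unsplitK.
Qed.

Variable M : monomType.
Local Notation A := (malg_algebra F M).

Lemma commutator_span_lin c (x y : A) :
  commutator_span x -> commutator_span y -> commutator_span (c *: x + y : A).
Proof.
move=> [n [a [u [v ->]]]] [m [b [s [t ->]]]].
exists (n + m)%N, (glue (fun j => c * a j) b), (glue u s), (glue v t).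
exact: (@commutator_sum_lin A).
Qed.

Lemma commutator_span_comm (x y : A) : commutator_span (x * y - y * x : A).
Proof.
by exists 1%N, (fun=> 1), (fun=> x), (fun=> y); rewrite big_ord1 scale1r.
Qed.

End CommutatorSpan.

(** * The given bracket on three generators *)

Section ThreeDimensional.
Variable F : fieldType.
Local Notation A := (malg_algebra F {fmonom 'I_3}).
Local Notation AA := (malg_algebra F ({fmonom 'I_3} * {fmonom 'I_3})%type).
Local Notation o0 := (@Ordinal 3 0 isT).
Local Notation o1 := (@Ordinal 3 1 isT).
Local Notation o2 := (@Ordinal 3 2 isT).
Local Notation E := (leibniz_ext (bracket3 F)).

Definition fgen (i : 'I_3) : A := fword F [:: i].
Definition fmu2 : AA -> A := mu F {fmonom 'I_3}.

Lemma fgen_ind (P : A -> Prop) :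
    P 1 -> (forall i y, P y -> P (fgen i * y)) ->
    (forall c x y, P x -> P y -> P (c *: x + y)) ->
  forall x, P x.
Proof. exact: (word_free_ind (@fword1 _ _) (@fword_cons _ _) (@fword_ind _ _)). Qed.

Lemma fmu2_lin : linear fmu2.
Proof. exact: linearP. Qed.

Lemma fmu2_tens a b : fmu2 (ftens a b) = a * b.
Proof. exact: mu_tens. Qed.

Definition single (a b : A) : A := fmu2 (fdbr E a b).

Lemma fcyclic1 k z : cyclic (F := F) (I := 'I_3) k 1 z = 0.
Proof. exact: (cyclic1 (@fword1 _ _) (@cyclic_fword _ _)). Qed.

Lemma fcyclic_cons k i y z :
  cyclic k (fgen i * y) z = (y * z) *+ (i == k) + cyclic k y (z * fgen i).
Proof.
exact: (cyclic_cons (@fword_cons _ _) (@fword_ind _ _) (@cyclic_linl _ _)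
  (@cyclic_fword _ _)).
Qed.

Lemma fcyclic_linr k a : linear (cyclic (F := F) (I := 'I_3) k a).
Proof.
exact: (cyclic_linr (@fword1 _ _) (@fword_cons _ _) (@fword_ind _ _)
  (@cyclic_linl _ _) (@cyclic_fword _ _)).
Qed.

Lemma ord3_all (i : 'I_3) : i \in [:: o0; o1; o2].
Proof. by case: i => -[|[|[|]]]. Qed.

Lemma bracket3_gens i j :
  fdbr E (fgen i) (fgen j) = fincl2 (bracket3_basis F (i, j)).
Proof.
rewrite leibniz_ext_gen /free_bracket; congr fincl2.
by rewrite /dbr tensU [LHS]linextU.
Qed.

Let lin2 := @fincl2_lin F 'I_3.

Lemma single_poisson3 :
  (forall a b c,
     single a (single b c) - single b (single a c) = single (single a b) c) /\
  (forall a b, commutator_span (single a b + single b a : A)).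
Proof.
apply: (three_generator_poisson (x := o0) (y := o1) (z := o2) fgen_ind
  (@cyclic_linl _ _) fcyclic_linr fcyclic1 fcyclic_cons (@ftens_linl _ _)
  (@ftensM _ _) (@ftens11 _ _) (@ftens_ind _ _) fmu2_lin fmu2_tens (fdbr_linl E)
  (fdbr_linr E) (leibniz_ext_leibniz (bracket3 F)) isT ord3_all).
- by rewrite bracket3_gens (lin_fun0 lin2).
- by rewrite bracket3_gens (lin_funN lin2) fincl2U.
- by rewrite bracket3_gens (lin_fun0 lin2).
- by rewrite bracket3_gens fincl2U.
- by rewrite bracket3_gens (lin_fun0 lin2).
- by rewrite bracket3_gens fincl2U.
- by rewrite bracket3_gens (lin_funB lin2); congr (_ - _); exact: fincl2U.
- by rewrite bracket3_gens (lin_funN lin2) fincl2U.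
- by rewrite bracket3_gens (lin_fun0 lin2).
- exact: commutator_span_lin.
- exact: commutator_span_comm.
Qed.

End ThreeDimensional.

Theorem corollary4 (F : fieldType) :
  exists E : double_bracket F {fmonom 'I_3},
    [/\ leibniz_extension (bracket3 F) E,
        forall E' : double_bracket F {fmonom 'I_3},
          leibniz_extension (bracket3 F) E' -> E' =1 E
      & modified_double_poisson E].
Proof.
exists (leibniz_ext (bracket3 F)); split.
- exact: leibniz_ext_extension.
- exact: leibniz_extension_unique.
- have [jacobi skew] := single_poisson3 F; split.
  + by apply/fdbr_leibniz; exact: leibniz_ext_leibniz.
  + exact: jacobi.
  + exact: skew.
Qed.
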